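(* Let $R$ be a principal ideal domain, let $N\in R$ be nonzero and not a unit, let $S=(R/NR)[x_1,\dots,x_n]$, and let $M$ be a finitely generated $S$-module. Suppose $M\cong F/U$, where $F=\bigoplus_{i=1}^rS$ is a finitely generated free $S$-module and $U\subseteq F$ is a submodule which, with respect to some monomial order on $F$, has a Gröbner basis all of whose elements have leading coefficients that are nonzerodivisors in $R/NR$. Then $M$ admits a free $S$-resolution $$0\to F_p\to F_{p-1}\to\dots\to F_1\to F_0\to M\to 0$$ of length $p\le n+1$.
   Context: Let $e_1,\dots,e_r$ be the standard basis of $F$. A monomial of $F$ is an element $ue_i$ with $u$ a monomial of $S$. A monomial order on $F$ is a total order $>$ on the monomials of $F$ such that $wm>m$ for every monomial $m$ of $F$ and every monomial $w\ne1$ of $S$, and such that $m>m'$ implies $wm>wm'$. For $0\neq f\in F$ whose largest monomial is $ue_i$, with coefficient $a\neq 0$, the leading term is $\operatorname{LT}(f)=aue_i$ and the leading coefficient is $\operatorname{lc}(f)=a$. $\operatorname{LT}(U)$ is the $S$-submodule of $F$ generated by the leading terms of the elements of $U$. A finite set $\{f_1,\dots,f_m\}\subseteq U$ is a Gröbner basis of $U$ if $\langle\operatorname{LT}(f_1),\dots,\operatorname{LT}(f_m)\rangle=\operatorname{LT}(U)$. *)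

(* Defs.v *)
From HB Require Import structures.
From mathcomp Require Import all_boot all_order all_algebra.
From mathcomp Require Import boolp.
From mathcomp Require Import mpoly.

Set Implicit Arguments.
Unset Strict Implicit.
Unset Printing Implicit Defensive.

Import GRing.Theory.

Local Open Scope ring_scope.
Local Open Scope quotient_scope.

Definition is_pid (R : idomainType) : Prop :=
  forall I : R -> Prop,
    I 0 ->
    (forall x y, I x -> I y -> I (x + y)) ->
    (forall a x, I x -> I (a * x)) ->
    exists g, forall x, I x <-> exists a, x = a * g.

(* The predicate carries the proof that N is not a unit because MathComp only
   puts a ring structure on the quotient by a proper ideal.  Membership is
   made boolean classically: no decidability is assumed of R. *)
Definition multiples (R : comUnitRingType) (N : R) (hN : N \isn't a GRing.unit)
  : pred R := fun x => `[< exists a, x = a * N >].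

Lemma multiples_idealr (R : comUnitRingType) (N : R)
    (hN : N \isn't a GRing.unit) : idealr_closed (multiples hN).
Proof.
split; rewrite ?/multiples.
- by apply/asboolP; exists 0; rewrite mul0r.
- apply/negP => /asboolP[a ea]; case/negP: hN; apply/unitrPr.
  by exists a; rewrite mulrC -ea.
- move=> a x y /asboolP[b ->] /asboolP[c ->]; apply/asboolP.
  by exists (a * b + c); rewrite mulrDl mulrA.
Qed.

HB.instance Definition _ (R : comUnitRingType) (N : R)
    (hN : N \isn't a GRing.unit) :=
  isIdealr.Build R (multiples hN) (multiples_idealr hN).

Definition quot_principal (R : comUnitRingType) (N : R)
  (hN : N \isn't a GRing.unit) := 
  {ideal_quot (Idealr.clone R (multiples hN) _)}.

HB.instance Definition _ (R : comUnitRingType) (N : R)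
    (hN : N \isn't a GRing.unit) :=
  NzRingQuotient.on (quot_principal hN).
HB.instance Definition _ (R : comUnitRingType) (N : R)
    (hN : N \isn't a GRing.unit) :=
  GRing.ComNzRing.on (quot_principal hN).

Section QuotientModule.
Variables (S : nzRingType) (V : lmodType S) (U : submodClosed V).

(* MathComp's submodClosed is stated over semirings and so does not record
   closure under opposite, which its additive quotient requires. *)
Definition submod_pred : pred V := fun x => x \in U.

Fact submod_pred_closed : zmod_closed submod_pred.
Proof.
split=> [|x y Ux Uy]; first exact: rpred0.
by have := rpredD Ux (rpredZ (-1) Uy); rewrite scaleN1r.
Qed.

HB.instance Definition _ := GRing.isZmodClosed.Build V submod_pred
  submod_pred_closed.

Definition quot_module :=
  {ideal_quot (GRing.ZmodClosed.clone V submod_pred _)}.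
HB.instance Definition _ := ZmodQuotient.on quot_module.

Definition quot_scale (a : S) (x : quot_module) : quot_module :=
  \pi_quot_module (a *: repr x).

Lemma quot_moduleE v w :
  (\pi_quot_module v = \pi_quot_module w) <-> (v - w \in U).
Proof.
have e := @Quotient.idealrBE _ (GRing.ZmodClosed.clone V submod_pred _) v w.
by split=> [/eqP|h]; [rewrite -e | apply/eqP; rewrite -e].
Qed.

Lemma quot_moduleP (x : quot_module) : exists v, x = \pi_quot_module v.
Proof. by exists (repr x); rewrite reprK. Qed.

Lemma quot_scale_pi a v :
  quot_scale a (\pi_quot_module v) = \pi_quot_module (a *: v).
Proof.
apply/quot_moduleE; rewrite -scalerBr; apply: rpredZ.
by apply/quot_moduleE; rewrite reprK.
Qed.

Fact quot_scaleA a b x : quot_scale a (quot_scale b x) = quot_scale (a * b) x.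
Proof. by have [v ->] := quot_moduleP x; rewrite !quot_scale_pi scalerA. Qed.

Fact quot_scale1 : left_id 1 quot_scale.
Proof.
by move=> x; have [v ->] := quot_moduleP x; rewrite quot_scale_pi scale1r.
Qed.

Fact quot_piD v w :
  \pi_quot_module (v + w) = \pi_quot_module v + \pi_quot_module w.
Proof. exact: (pi_addr (s := quot_module)). Qed.

Fact quot_scaleDr : right_distributive quot_scale +%R.
Proof.
move=> a x y; have [v ->] := quot_moduleP x; have [w ->] := quot_moduleP y.
by rewrite -quot_piD !quot_scale_pi scalerDr quot_piD.
Qed.

Fact quot_scaleDl x : {morph quot_scale^~ x : a b / a + b}.
Proof.
by have [v ->] := quot_moduleP x => a b; rewrite !quot_scale_pi scalerDl quot_piD.
Qed.

HB.instance Definition _ := GRing.Zmodule_isLmodule.Build S quot_module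
  quot_scaleA quot_scale1 quot_scaleDr quot_scaleDl.

End QuotientModule.

Section Modules.
Variables (S : nzRingType).

Definition in_span (V : lmodType S) (P : V -> Prop) (x : V) : Prop :=
  exists s : seq (S * V),
    (forall c, c \in s -> P c.2) /\ x = \sum_(c <- s) c.1 *: c.2.

Definition finitely_generated (V : lmodType S) : Prop :=
  exists s : seq V, forall x, in_span (fun v => v \in s) x.

Definition isomorphic (V W : lmodType S) : Prop :=
  exists f : {linear V -> W}, bijective f.

Definition is_basis (V : lmodType S) (B : V -> Prop) : Prop :=
  (forall x, in_span B x) /\
  (forall (s : seq V) (c : V -> S), uniq s -> (forall v, v \in s -> B v) ->
     \sum_(v <- s) c v *: v = 0 -> forall v, v \in s -> c v = 0).

Definition is_free (V : lmodType S) : Prop := exists B, @is_basis V B.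

(* A resolution 0 -> F_p -> ... -> F_0 -> M -> 0 is encoded as a chain of
   modules indexed by nat that vanishes above p; injectivity of F_p -> F_{p-1}
   (of F_0 -> M when p = 0) is the exactness condition at F_p. *)
Definition has_free_resolution (M : lmodType S) (p : nat) : Prop :=
  exists (F : nat -> lmodType S)
         (d : forall i, {linear F i.+1 -> F i})
         (eps : {linear F 0%N -> M}),
    [/\ forall i, is_free (F i),
        forall i, (p < i)%N -> forall x : F i, x = 0,
        forall y, exists x, eps x = y,
        forall x, eps x = 0 <-> exists y, d 0%N y = x
      & forall i x, d i x = 0 <-> exists y, d i.+1 y = x].

End Modules.

Section Groebner.
Variables (A : comNzRingType) (n r : nat).
Local Notation S := {mpoly A[n]}.
Local Notation F := 'rV[S]_r.

Definition nonzerodivisor (a : A) : Prop := forall b, a * b = 0 -> b = 0.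

(* (u, i) stands for the monomial x^u e_i of F. *)
Definition fmon : Type := ('X_{1..n} * 'I_r)%type.
HB.instance Definition _ := Equality.on fmon.

Definition fmon_mul (w : 'X_{1..n}) (m : fmon) : fmon := ((w + m.1)%MM, m.2).

Definition fmon_elt (m : fmon) : F := 'X_[m.1] *: delta_mx 0 m.2.

Definition is_monomial_order (gt : rel fmon) : Prop :=
  [/\ irreflexive gt, transitive gt,
      forall m m', m != m' -> gt m m' || gt m' m,
      forall w m, w != 0%MM -> gt (fmon_mul w m) m
    & forall w m m', gt m m' -> gt (fmon_mul w m) (fmon_mul w m')].

Definition fcoeff (f : F) (m : fmon) : A := (f 0 m.2)@_(m.1).

Definition fsupp (f : F) : seq fmon :=
  [seq (u, i) | i <- enum 'I_r, u <- msupp (f 0 i)].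

(* The largest monomial of f; None only when f = 0, in which case LT and lc
   below are 0 by convention. *)
Definition lmon (gt : rel fmon) (f : F) : option fmon :=
  ohead [seq m <- fsupp f | all (fun m' => (m == m') || gt m m') (fsupp f)].

Definition lc (gt : rel fmon) (f : F) : A :=
  if lmon gt f is Some m then fcoeff f m else 0.

Definition LT (gt : rel fmon) (f : F) : F :=
  if lmon gt f is Some m then (lc gt f)%:MP *: fmon_elt m else 0.

Definition in_LT (gt : rel fmon) (P : F -> Prop) : F -> Prop :=
  in_span (fun t => exists f, [/\ P f, f != 0 & t = LT gt f]).

Definition is_groebner_basis (gt : rel fmon) (U : F -> Prop) (G : seq F)
  : Prop :=
  [/\ forall g, g \in G -> U g,
      forall g, g \in G -> g != 0
    & forall x, in_LT gt (fun g => g \in G) x <-> in_LT gt U x].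

End Groebner.

(* Main.v *)
Require Import Defs.
From HB Require Import structures.
From mathcomp Require Import all_boot all_order all_algebra.
From mathcomp Require Import boolp finmap.
From mathcomp Require monalg.
Import (canonicals) monalg.
From mathcomp Require Import mpoly.

Set Implicit Arguments.
Unset Strict Implicit.
Unset Printing Implicit Defensive.

Import GRing.Theory.

Local Open Scope ring_scope.

(** Write A = R/NR and S = A[x_1, ..., x_n].  In a quotient of a principal ideal
    domain by a nonzero element every nonzerodivisor is a unit
    ([nonzerodivisor_quot_unit]), so the leading coefficients of the Groebner
    basis G are invertible and division by G works as over a field.  Hence F/U is
    free over A: the monomials divisible by no leading monomial of G span it
    ([standard_span]) and are independent in it ([standard_independent]).
    Division terminates because a monomial order is well founded, which is
    Dickson's lemma ([monomial_order_wf]).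

    An S-module that is free over A has a free S-resolution of length n.  For any
    S-module N and any variable x_i there is a short exact sequence of S-modules
        0 -> N[y] -> N[y] -> N -> 0
    whose first map is multiplication by y - x_i and whose second one evaluates at
    y = x_i; here x_i acts on N[y] as y, while the other variables act on the
    coefficients ([adjoin_exact]).  If N is free over a polynomial ring in some of
    the variables other than x_i, then N[y] is free over the polynomial ring in
    these variables and x_i, on the same basis ([free_adjoin]).  Going through all
    the variables, one reaches a free S-module after n steps, and each step
    lengthens the resolution by one, because the cokernel of an injection between
    modules with free resolutions of length p has one of length p + 1
    ([free_dim_le_cokernel]).  The last fact is the mapping cone in disguise; it
    follows from the horseshoe lemma ([free_dim_le_extension]).  The result is
    the Koszul resolution on x_1 - y_1, ..., x_n - y_n, built one variable at a
    time. *)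

(** * Finitely supported functions *)

(* [mono k v] is the function with value v at k and 0 elsewhere. *)
Local Notation fsupported := monalg.malg.
Local Notation mono := monalg.mkmalgU.
Local Notation coef := monalg.mcoeff.

Section Extension.
Variables (I : choiceType) (G W : zmodType).

Lemma fsupported_sum (f : fsupported I G) :
  f = \sum_(k <- monalg.msupp f) mono k (coef k f).
Proof. exact: monalg.monalgE. Qed.

Lemma additive_ext (g h : {additive fsupported I G -> W}) :
  (forall k v, g (mono k v) = h (mono k v)) -> g =1 h.
Proof.
move=> gh f; rewrite [f]fsupported_sum !raddf_sum.
by apply: eq_bigr => k _; apply: gh.
Qed.

Variable phi : I -> {additive G -> W}.

(** The additive map determined by its values on the functions supported at one
    point. *)
Definition extend (f : fsupported I G) : W :=
  \sum_(k <- monalg.msupp f) phi k (coef k f).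

Lemma extendEw (d : {fset I}) f : (monalg.msupp f `<=` d)%fset ->
  extend f = \sum_(k <- d) phi k (coef k f).
Proof.
move=> le; rewrite [LHS](big_fset_incl _ le) // => k _ /monalg.mcoeff_outdom ->.
exact: raddf0.
Qed.

Lemma extend_is_additive : zmod_morphism extend.
Proof.
move=> f g; pose d := (monalg.msupp f `|` monalg.msupp g)%fset.
rewrite (@extendEw d f) ?fsubsetUl // (@extendEw d g) ?fsubsetUr //.
rewrite (@extendEw d (f - g)) ?monalg.msuppB_le // -sumrB.
by apply: eq_bigr => k _; rewrite !raddfB.
Qed.

HB.instance Definition _ :=
  GRing.isZmodMorphism.Build (fsupported I G) W extend extend_is_additive.

Lemma extend_mono k v : extend (mono k v) = phi k v.
Proof.
rewrite (extendEw monalg.msuppU_le) big_seq_fset1.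
by rewrite monalg.mcoeffUU.
Qed.
End Extension.

(** * Linear maps and free modules *)

Section LinearMaps.
Variable S : nzRingType.

Lemma linear_of (V W : lmodType S) (f : V -> W) :
  linear f -> exists g : {linear V -> W}, g =1 f.
Proof.
move=> fL; pose g : {linear V -> W} :=
  HB.pack f (GRing.isLinear.Build S V W *:%R f fL).
by exists g.
Qed.

(** Stands in for every construction of a map into a submodule: kernels are only
    known through an injection. *)
Lemma factor_injective (V W X : lmodType S) (i : {linear V -> W})
    (f : {linear X -> W}) :
  injective i -> (forall x, exists v, i v = f x) ->
  exists g : {linear X -> V}, forall x, i (g x) = f x.
Proof.
move=> i_inj /choice[g gE].
have [|h hE] := @linear_of _ _ g; last by exists h => x; rewrite hE gE.
by move=> a x y; apply: i_inj; rewrite linearP !gE linearP.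
Qed.

Lemma linear_bij_inv (V W : lmodType S) (f : {linear V -> W}) : bijective f ->
  exists2 g : {linear W -> V}, cancel f g & cancel g f.
Proof.
move=> fbij; have [f' fK f'K] := fbij.
have [||g gE] := @factor_injective _ _ _ f (idfun : {linear W -> W}).
- exact: bij_inj.
- by move=> x; exists (f' x); apply: f'K.
- by exists g => [x|x] /=; [apply: (bij_inj fbij); rewrite gE | rewrite gE].
Qed.

Section Kernel.
Variables (V W : lmodType S) (f : {linear V -> W}).

Definition in_kernel : pred V := fun x => f x == 0.

Fact in_kernel_submod : submod_closed in_kernel.
Proof.
split=> [|a x y]; first by rewrite unfold_in /in_kernel linear0.
by rewrite !unfold_in /in_kernel linearP => /eqP-> /eqP->; rewrite scaler0 addr0.
Qed.

HB.instance Definition _ := GRing.isSubmodClosed.Build S V in_kernel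
  in_kernel_submod.

Record kernel := Kernel { kernel_val : V; _ : in_kernel kernel_val }.
HB.instance Definition _ := [isSub for kernel_val].
HB.instance Definition _ := [Choice of kernel by <:].
HB.instance Definition _ := [SubChoice_isSubLmodule of kernel by <:].
End Kernel.

Definition short_exact (X Y Z : lmodType S)
    (f : {linear X -> Y}) (g : {linear Y -> Z}) : Prop :=
  [/\ injective f, forall z, exists y, g y = z
    & forall y, g y = 0 <-> exists x, f x = y].

Lemma kernel_exact (V W : lmodType S) (f : {linear V -> W}) :
  (forall y, exists x, f x = y) ->
  exists (K : lmodType S) (i : {linear K -> V}), short_exact i f.
Proof.
move=> f_surj; exists (kernel f), (val : {linear kernel f -> V}).
split=> // [|x]; first exact: val_inj.
split=> [/eqP fx|[y <-]]; first by exists (Kernel fx).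
by apply/eqP; case: y.
Qed.

Section LinearCombination.
Variables (I : choiceType) (V : lmodType S) (b : I -> V).

Fact scale_left_is_additive (v : V) : zmod_morphism (fun c : S => c *: v).
Proof. by move=> c d; rewrite scalerBl. Qed.

Definition scale_left v : {additive S -> V} :=
  HB.pack (fun c : S => c *: v)
    (GRing.isZmodMorphism.Build S V (fun c : S => c *: v)
       (scale_left_is_additive v)).

Definition lincomb : fsupported I S -> V := extend (fun k => scale_left (b k)).

HB.instance Definition _ := GRing.Additive.on lincomb.

Fact lincomb_is_scalable : scalable lincomb.
Proof.
move=> c f; rewrite /lincomb (extendEw _ (monalg.msuppZ_le c f)) /extend.
by rewrite scaler_sumr; apply: eq_bigr => k _; rewrite /= monalg.mcoeffZ scalerA.
Qed.

HB.instance Definition _ :=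
  GRing.isScalable.Build S (fsupported I S) V *:%R lincomb lincomb_is_scalable.

Lemma lincomb_mono k c : lincomb (mono k c) = c *: b k.
Proof. exact: extend_mono. Qed.

End LinearCombination.

Lemma monoZ (I : choiceType) (k : I) (c : S) :
  mono k c = c *: mono k 1 :> fsupported I S.
Proof.
by apply/monalg.malgP => j; rewrite monalg.mcoeffZ !monalg.mcoeffU mulrnAr mulr1.
Qed.

Lemma linear_ext (I : choiceType) (V : lmodType S)
    (f g : {linear fsupported I S -> V}) :
  (forall k, f (mono k 1) = g (mono k 1)) -> f =1 g.
Proof.
have scale_mono (h : {linear fsupported I S -> V}) k c :
  h (mono k c) = c *: h (mono k 1) by rewrite monoZ linearZ.
move=> fg; apply: additive_ext => k c.
by rewrite [LHS](scale_mono f) [RHS](scale_mono g) fg.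
Qed.

(** Freeness with a concrete model, in which linear maps out of a free module and
    coordinates are explicit; [free_is_free] returns to bases as subsets. *)
Definition free_module (V : lmodType S) : Prop :=
  exists (I : choiceType) (f : {linear fsupported I S -> V}), bijective f.

Lemma free_lift (F V W : lmodType S) (q : {linear V -> W}) (g : {linear F -> W}) :
  free_module F -> (forall w, exists v, q v = w) ->
  exists h : {linear F -> V}, forall x, q (h x) = g x.
Proof.
move=> [I [f fbij]] qsurj; have [f' _ f'K] := linear_bij_inv fbij.
have [b bE] := choice (fun k => qsurj (g (f (mono k 1)))).
exists (lincomb b \o f') => x /=; rewrite -{2}[x]f'K; move: (f' x).
apply: (@linear_ext _ _ (q \o lincomb b) (g \o f)) => k /=.
by rewrite lincomb_mono scale1r bE.
Qed.

Lemma free_iso (V W : lmodType S) (f : {linear V -> W}) :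
  bijective f -> free_module V -> free_module W.
Proof.
by move=> fbij [I [g gbij]]; exists I, (f \o g); apply: bij_comp.
Qed.

Lemma free_trivial (V : lmodType S) : (forall x : V, x = 0) -> free_module V.
Proof.
move=> V0; pose f : {linear fsupported void S -> V} := lincomb (fun=> 0).
exists void, f; exists (fun=> 0) => x; last by rewrite [RHS]V0.
by apply/monalg.malgP => [[]].
Qed.

Lemma free_pair (V W : lmodType S) :
  free_module V -> free_module W -> free_module (V * W)%type.
Proof.
move=> [I [f fbij]] [J [g gbij]].
have [f' fK f'K] := linear_bij_inv fbij; have [g' gK g'K] := linear_bij_inv gbij.
pose b (k : (I + J)%type) : (V * W)%type :=
  match k with inl i => (f (mono i 1), 0) | inr j => (0, g (mono j 1)) end.
pose inI : {linear fsupported I S -> fsupported (I + J)%type S} :=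
  lincomb (fun i => mono (inl i) 1).
pose inJ : {linear fsupported J S -> fsupported (I + J)%type S} :=
  lincomb (fun j => mono (inr j) 1).
pose h1 : {linear (V * W)%type -> V} := fst.
pose h2 : {linear (V * W)%type -> W} := snd.
exists (I + J)%type, (lincomb b); exists (fun x => inI (f' x.1) + inJ (g' x.2)).
  apply: (@linear_ext _ _ ((inI \o (f' \o (h1 \o lincomb b))) \+
    (inJ \o (g' \o (h2 \o lincomb b)))) idfun) => -[i|j] /=.
    by rewrite lincomb_mono scale1r /= fK linear0 linear0 addr0 lincomb_mono scale1r.
  by rewrite lincomb_mono scale1r /= gK linear0 linear0 add0r lincomb_mono scale1r.
have combI u : lincomb b (inI u) = (f u, 0).
  apply: injective_projections.
    apply: (@linear_ext _ _ (h1 \o (lincomb b \o inI)) f) => k /=.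
    by rewrite !(lincomb_mono, scale1r).
  apply: (@linear_ext _ _ (h2 \o (lincomb b \o inI)) (\0 : {linear _ -> _})) => k /=.
  by rewrite !(lincomb_mono, scale1r).
have combJ u : lincomb b (inJ u) = (0, g u).
  apply: injective_projections.
    apply: (@linear_ext _ _ (h1 \o (lincomb b \o inJ)) (\0 : {linear _ -> _})) => k /=.
    by rewrite !(lincomb_mono, scale1r).
  apply: (@linear_ext _ _ (h2 \o (lincomb b \o inJ)) g) => k /=.
  by rewrite !(lincomb_mono, scale1r).
case=> x y; rewrite [LHS]linearD [X in X + _]combI [X in _ + X]combJ /= f'K g'K.
by apply: injective_projections; rewrite /= ?addr0 ?add0r.
Qed.

(** Independence is about a list of distinct vectors, so the indices chosen for
    them are distinct as well. *)
Lemma free_is_free (V : lmodType S) : free_module V -> is_free V.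
Proof.
move=> [I [f fbij]]; have [f' fK f'K] := linear_bij_inv fbij.
exists (fun v => exists k, v = f (mono k 1)); split=> [x|s c s_uniq sB].
  exists [seq (coef k (f' x), f (mono k 1)) | k <- monalg.msupp (f' x)].
  split=> [p /mapP[k _ ->]|]; first by exists k.
  rewrite big_map /= -{1}[x]f'K {1}[f' x]fsupported_sum linear_sum.
  by apply: eq_bigr => k _; rewrite monoZ linearZ.
move=> sum0 v0 v0s.
have [k kE] : exists k : V -> I, forall v, v \in s -> v = f (mono (k v) 1).
  have i0 : I by case: (cid (sB _ v0s)).
  have kP v : exists i, v \in s -> v = f (mono i 1).
    by have [/sB[i iE]|vNs] := boolP (v \in s); [exists i | exists i0].
  by have [k kE] := choice kP; exists k.
have h0 : \sum_(v <- s) c v *: mono (k v) 1 = 0 :> fsupported I S.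
  apply: (bij_inj fbij); rewrite linear0 linear_sum -{}[RHS]sum0.
  by apply: eq_big_seq => v vs; rewrite linearZ /= -kE.
have := congr1 (coef (k v0)) h0; rewrite raddf_sum raddf0 (bigD1_seq v0) //=.
rewrite big_seq_cond big1 => [|v /andP[vs vNv0]].
  by rewrite addr0 monalg.mcoeffZ monalg.mcoeffUU mulr1.
rewrite monalg.mcoeffZ monalg.mcoeffU; case: eqP => [kv|_]; last by rewrite mulr0.
by case/eqP: vNv0; rewrite [v]kE // kv -kE.
Qed.

(** * Modules with a free resolution of bounded length *)

(** [free_dim_le p M] unfolds a resolution of length p by syzygies, which suits
    induction on p better than a chain of modules. *)
Fixpoint free_dim_le (p : nat) (M : lmodType S) : Prop :=
  match p with
  | 0 => free_module M
  | p'.+1 => exists (K F : lmodType S) (i : {linear K -> F}) (e : {linear F -> M}),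
      [/\ free_module F, short_exact i e & free_dim_le p' K]
  end.

Lemma free_dim_le_leS p (M : lmodType S) : free_dim_le p M -> free_dim_le p.+1 M.
Proof.
elim: p M => [|p IHp] M.
  move=> Mfree; exists ('rV[S]_0 : lmodType S), M.
  exists (\0 : {linear 'rV[S]_0 -> M}), (idfun : {linear M -> M}).
  split=> //; last by apply: free_trivial => x; apply/rowP => -[].
  split=> [x y _|z|y].
  - by apply/rowP => -[].
  - by exists z.
  - by split=> [/= ->|[x <-]] //; exists 0.
by move=> [K [F [i [e [Ffree ie Kres]]]]]; exists K, F, i, e; split=> //; apply: IHp.
Qed.

(** The horseshoe lemma: free covers FX of X and FZ of Z give a cover of Y by
    FX * FZ, the second factor mapping through a lift of FZ -> Z to Y, and its
    kernel is an extension of the kernel over Z by the kernel over X. *)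
Lemma free_dim_le_extension p (X Y Z : lmodType S)
    (i : {linear X -> Y}) (q : {linear Y -> Z}) :
  short_exact i q -> free_dim_le p X -> free_dim_le p Z -> free_dim_le p Y.
Proof.
elim: p X Y Z i q => [|p IHp] X Y Z i q [i_inj q_surj ker_q] /=.
  move=> Xfree Zfree.
  have [s sK] := free_lift (idfun : {linear Z -> Z}) Zfree q_surj.
  pose fX : {linear (X * Z)%type -> X} := fst.
  pose fZ : {linear (X * Z)%type -> Z} := snd.
  pose f : {linear (X * Z)%type -> Y} := (i \o fX) \+ (s \o fZ).
  have qi x : q (i x) = 0 by apply/ker_q; exists x.
  have fE x z : f (x, z) = i x + s z by [].
  apply: (@free_iso _ _ f); last exact: free_pair.
  have g_ex y : exists u, f u = y.
    have [|x ix] := (ker_q (y - s (q y))).1; first by rewrite linearB sK subrr.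
    by exists (x, q y); rewrite fE ix subrK.
  have [g gK] := choice g_ex; exists g => // u; move: (gK (f u)).
  case: (g _) => x z; case: u => x' z'; rewrite !fE => e.
  have zz' : z = z'.
    by have := congr1 q e; rewrite !linearD !qi !add0r !sK.
  by move: e; rewrite zz' => /addIr /i_inj ->.
(* Induction step: the kernel K of the cover e is an extension of KZ by KX. *)
move=> [KX [FX [iX [eX [FXfree [iX_inj eX_surj ker_eX] KXres]]]]].
move=> [KZ [FZ [iZ [eZ [FZfree [iZ_inj eZ_surj ker_eZ] KZres]]]]].
have [h hE] := free_lift eZ FZfree q_surj.
pose fX : {linear (FX * FZ)%type -> FX} := fst.
pose fZ : {linear (FX * FZ)%type -> FZ} := snd.
pose e : {linear (FX * FZ)%type -> Y} := (i \o (eX \o fX)) \+ (h \o fZ).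
have eE a b : e (a, b) = i (eX a) + h b by [].
have qi x : q (i x) = 0 by apply/ker_q; exists x.
have e_surj y : exists u, e u = y.
  have [b bE] := eZ_surj (q y).
  have [|x ix] := (ker_q (y - h b)).1; first by rewrite linearB hE bE subrr.
  by have [a aE] := eX_surj x; exists (a, b); rewrite eE aE ix subrK.
have [K [k [k_inj k_surj ker_e]]] := kernel_exact e_surj.
have ek x : e (k x) = 0 by apply/ker_e; exists x.
exists K, (FX * FZ)%type, k, e; split=> //; first exact: free_pair.
have [u uE] : exists u : {linear K -> KZ}, forall x, iZ (u x) = (fZ \o k) x.
  apply: factor_injective => // x; apply/ker_eZ => /=; rewrite -hE.
  have := congr1 q (ek x); rewrite /= linearD linear0 [X in X + _]qi add0r.
  by [].
have [w wE] : exists w : {linear KX -> K}, forall x, k (w x) = (iX x, 0).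
  have [|j jE] := @linear_of KX (FX * FZ)%type (fun x => (iX x, 0)).
    move=> a x y; rewrite linearP; apply: injective_projections => //=.
    by rewrite scaler0 addr0.
  have [|w wE] := factor_injective k_inj (f := j).
    move=> x; apply/ker_e; rewrite jE eE linear0 addr0.
    by rewrite [X in i X](_ : _ = 0) ?linear0 //; apply/ker_eX; exists x.
  by exists w => x; rewrite wE jE.
apply: (IHp _ _ _ w u) => //; split=> [x y wxy|c|y].
- by apply: iX_inj; have := congr1 k wxy; rewrite !wE => -[].
- have [|x ix] := (ker_q (h (iZ c))).1.
    by rewrite hE; apply/ker_eZ; exists c.
  have [a ea] := eX_surj x.
  have [|y ky] := (ker_e (- a, iZ c)).1; first by rewrite eE linearN ea linearN ix addNr.
  by exists y; apply: iZ_inj; rewrite uE /= ky.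
- have fZk : u y = 0 <-> (k y).2 = 0.
    rewrite -[(k y).2]uE; split=> [->|e0]; first exact: linear0.
    by apply: iZ_inj; rewrite linear0.
  rewrite fZk; split=> [k2|[x <-]]; last by rewrite wE.
  have [|x iXx] := (ker_eX (k y).1).1; last first.
    exists x; apply: k_inj; rewrite wE iXx -k2; exact: esym (surjective_pairing _).
  apply: i_inj; rewrite linear0; have := ek y.
  by rewrite [k y]surjective_pairing eE k2 linear0 addr0.
Qed.

(** If F covers Y with kernel KY, then the kernel K of the composite F -> Z is an
    extension of X by KY. *)
Lemma free_dim_le_cokernel p (X Y Z : lmodType S)
    (i : {linear X -> Y}) (q : {linear Y -> Z}) :
  short_exact i q -> free_dim_le p X -> free_dim_le p Y -> free_dim_le p.+1 Z.
Proof.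
move=> [i_inj q_surj ker_q] Xres /free_dim_le_leS.
move=> [KY [F [iY [e [Ffree [iY_inj e_surj ker_e] KYres]]]]].
have qi x : q (i x) = 0 by apply/ker_q; exists x.
have qe_surj z : exists a, (q \o e) a = z.
  by have [y <-] := q_surj z; have [a <-] := e_surj y; exists a.
have [K [k kqe]] := kernel_exact qe_surj; have [k_inj _ ker_qe] := kqe.
exists K, F, k, (q \o e); split=> //.
have qek x : q (e (k x)) = 0 by apply/ker_qe; exists x.
have [u uE] : exists u : {linear K -> X}, forall x, i (u x) = (e \o k) x.
  by apply: factor_injective => // x; apply/ker_q; apply: qek.
have [w wE] : exists w : {linear KY -> K}, forall x, k (w x) = iY x.
  apply: factor_injective => // x; apply/ker_qe => /=.
  by rewrite [e _](_ : _ = 0) ?linear0 //; apply/ker_e; exists x.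
apply: (@free_dim_le_extension _ KY K X w u) => //; split=> [x y wxy|x|y].
- by apply: iY_inj; rewrite -!wE wxy.
- have [a ea] := e_surj (i x).
  have [|y ky] := (ker_qe a).1; first by rewrite /= ea qi.
  by exists y; apply: i_inj; rewrite uE /= ky.
- split=> [uy|[x <-]].
    have [|x iYx] := (ker_e (k y)).1; first by rewrite -[e _]uE uy linear0.
    by exists x; apply: k_inj; rewrite wE.
  by apply: i_inj; rewrite uE /= wE linear0; apply/ker_e; exists x.
Qed.

(** Splices the short exact sequences of syzygies into one chain. *)
Lemma free_dim_le_resolution p (M : lmodType S) :
  free_dim_le p M -> has_free_resolution M p.
Proof.
elim: p M => [|p IHp] M.
  move=> Mfree.
  exists (fun k => if k is 0 then M else ('rV[S]_0 : lmodType S)).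
  exists (fun k => \0), (idfun : {linear M -> M}).
  have row0 (x : 'rV[S]_0) : x = 0 by apply/rowP => -[].
  split=> [[|k]|[|k]|y|x|k x] //.
  - exact/free_is_free.
  - by apply/free_is_free/free_trivial.
  - by exists y.
  - by split=> [/= ->|[y <-]] //; exists 0.
  - by split=> // _; exists 0; rewrite [x]row0.
move=> [K [E [i [e [/free_is_free Efree [i_inj e_surj ker_e] /IHp]]]]].
move=> [F [d [eps [Ffree F0 eps_surj ker_eps ker_d]]]].
pose F' k := if k is k'.+1 then F k' else E.
pose d' k : {linear F' k.+1 -> F' k} :=
  match k with 0 => i \o eps | k'.+1 => d k' end.
exists F', d', e.
split=> [[|k]|[|k]|y|x|[|k] x] //; try exact: F0.
- exact: Ffree.
- rewrite ker_e; split=> [[y <-]|[y <-]]; last by exists (eps y).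
  by have [z <-] := eps_surj y; exists z.
- rewrite -ker_eps; split=> /= [ix|->]; last exact: linear0.
  by apply: i_inj; rewrite ix linear0.
- exact: ker_d.
Qed.

Lemma resolution_isomorphic p (M Q : lmodType S) :
  isomorphic M Q -> has_free_resolution Q p -> has_free_resolution M p.
Proof.
move=> [f /linear_bij_inv[g fK gK]].
move=> [F [d [eps [F_free F_van eps_surj ker_eps ker_d]]]].
exists F, d, (g \o eps); split=> // [y|x].
  by have [x ex] := eps_surj (f y); exists x; rewrite /= ex fK.
rewrite -ker_eps /=; split=> [gx|->]; last exact: linear0.
by rewrite -[eps x]gK gx linear0.
Qed.

End LinearMaps.

(** * The module N[y] over S[y] *)

Lemma fsupported_ind (I : choiceType) (G : zmodType) (P : fsupported I G -> Prop) :
  P 0 -> (forall k v, P (mono k v)) -> (forall f g, P f -> P g -> P (f + g)) ->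
  forall f, P f.
Proof.
by move=> P0 Pmono PD f; rewrite [f]fsupported_sum; apply: big_ind.
Qed.

Lemma poly_monomial_ind (S : nzRingType) (P : {poly S} -> Prop) :
  P 0 -> (forall a c, P (c *: 'X^a)) -> (forall p q, P p -> P q -> P (p + q)) ->
  forall p, P p.
Proof.
by move=> P0 Pmono PD p; rewrite -[p]coefK poly_def; apply: big_ind.
Qed.

Section PolynomialModule.
Variables (S : comNzRingType) (N : lmodType S).

(** N[y], with [mono k v] for v * y^k. *)
Definition poly_module := fsupported nat N.
HB.instance Definition _ := GRing.Zmodule.on poly_module.
Local Notation cst v := (mono 0%N v : poly_module).

Definition poly_act_term (p : {poly S}) (k : nat) (v : N) : poly_module :=
  \sum_(j < size p) mono (j + k)%N (p`_j *: v).

Fact poly_act_term_is_additive p k : zmod_morphism (poly_act_term p k).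
Proof.
move=> v w; rewrite -sumrB; apply: eq_bigr => j _.
by rewrite scalerBr raddfB.
Qed.
HB.instance Definition _ p k :=
  GRing.isZmodMorphism.Build N poly_module (poly_act_term p k)
    (poly_act_term_is_additive p k).

Definition poly_act (p : {poly S}) : poly_module -> poly_module :=
  extend (poly_act_term p).
HB.instance Definition _ p := GRing.Additive.on (poly_act p).

Lemma poly_act_widen (p : {poly S}) k v m : (size p <= m)%N ->
  poly_act p (mono k v) = \sum_(j < m) mono (j + k)%N (p`_j *: v).
Proof.
move=> le_pm; rewrite [LHS]extend_mono /= /poly_act_term.
rewrite (big_ord_widen _ (fun j => mono (j + k)%N (p`_j *: v)) le_pm) big_mkcond.
apply: eq_bigr => j _; case: ltnP => // le_pj.
by rewrite nth_default // scale0r raddf0.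
Qed.

Lemma poly_act_mono c a k v :
  poly_act (c *: 'X^a) (mono k v) = mono (a + k)%N (c *: v).
Proof.
rewrite (@poly_act_widen _ _ _ a.+1); last first.
  by rewrite (leq_trans (size_scale_leq _ _)) // size_polyXn.
rewrite big_ord_recr big1 /= => [|j _].
  by rewrite add0r coefZ coefXn eqxx mulr1.
by rewrite coefZ coefXn ltn_eqF // mulr0 scale0r raddf0.
Qed.

Fact poly_actDl f : {morph poly_act^~ f : p q / p + q}.
Proof.
move=> p q; elim/fsupported_ind: f => [|k v|f g IHf IHg].
- by rewrite !raddf0 addr0.
- pose m := maxn (size p) (size q).
  rewrite !(@poly_act_widen _ _ _ m) ?leq_maxl ?leq_maxr ?size_polyD //.
  by rewrite -big_split; apply: eq_bigr => j _; rewrite coefD scalerDl raddfD.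
- rewrite /= in IHf IHg *; rewrite !raddfD /= IHf IHg.
  exact: addrACA.
Qed.

(** All three arguments are additive, so monomials suffice. *)
Fact poly_actA p q f : poly_act p (poly_act q f) = poly_act (p * q) f.
Proof.
have act0 g : poly_act 0 g = 0.
  by apply: (addrI (poly_act 0 g)); rewrite -poly_actDl !addr0.
elim/fsupported_ind: f => [|k v|f g IHf IHg]; first by rewrite !raddf0.
  elim/poly_monomial_ind: p => [|a c|p p' IHp IHp']; first by rewrite mul0r !act0.
    elim/poly_monomial_ind: q => [|b d|q q' IHq IHq'].
    - by rewrite mulr0 !act0 raddf0.
    - rewrite -scalerAl -scalerAr -exprD scalerA !poly_act_mono scalerA.
      by rewrite addnA.
    - by rewrite mulrDr !poly_actDl raddfD /= IHq IHq'.
  by rewrite mulrDl !poly_actDl IHp IHp'.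
by rewrite !raddfD /= IHf IHg.
Qed.

Fact poly_act1 : left_id 1 poly_act.
Proof.
elim/fsupported_ind => [|k v|f g IHf IHg]; first by rewrite raddf0.
  by rewrite -[1]scale1r -(expr0 'X) poly_act_mono scale1r.
by rewrite raddfD /= IHf IHg.
Qed.

Fact poly_actDr : right_distributive poly_act +%R.
Proof. by move=> p f g; rewrite raddfD. Qed.

HB.instance Definition _ := GRing.Zmodule_isLmodule.Build {poly S} poly_module
  poly_actA poly_act1 poly_actDr poly_actDl.

Lemma scale_mono (c : S) a k (v : N) :
  (c *: 'X^a) *: (mono k v : poly_module) = mono (a + k)%N (c *: v).
Proof. exact: poly_act_mono. Qed.

Lemma scale_mono_const c k (v : N) :
  c%:P *: (mono k v : poly_module) = mono k (c *: v).
Proof. by rewrite -[c%:P]mulr1 -(expr0 'X) mul_polyC scale_mono. Qed.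

Section Evaluation.
Variable t : S.

Definition eval_term k (v : N) : N := t ^+ k *: v.

Fact eval_term_is_additive k : zmod_morphism (eval_term k).
Proof. by move=> v w; rewrite /eval_term scalerBr. Qed.
HB.instance Definition _ k := GRing.isZmodMorphism.Build N N (eval_term k)
  (eval_term_is_additive k).

Definition eval_at : poly_module -> N := extend eval_term.
HB.instance Definition _ := GRing.Additive.on eval_at.

Lemma eval_at_mono k v : eval_at (mono k v) = t ^+ k *: v.
Proof. exact: extend_mono. Qed.

Lemma eval_at_scale p f : eval_at (p *: f) = p.[t] *: eval_at f.
Proof.
elim/fsupported_ind: f => [|k v|f g IHf IHg].
- by rewrite scaler0 raddf0 scaler0.
- elim/poly_monomial_ind: p => [|a c|p q IHp IHq].
  + by rewrite scale0r horner0 scale0r raddf0.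
  + rewrite scale_mono !eval_at_mono hornerZ hornerXn !scalerA exprD.
    by rewrite mulrC mulrA.
  + by rewrite scalerDl hornerD raddfD /= IHp IHq scalerDl.
- by rewrite scalerDr !raddfD /= IHf IHg.
Qed.

Lemma eval_at_surj v : eval_at (cst v) = v.
Proof. by rewrite eval_at_mono expr0 scale1r. Qed.

(** It suffices that f differs from the constant [eval_at f] by a multiple of
    y - t; on v * y^k this is the factorization of y^k - t^k. *)
Lemma eval_at_kernel f :
  eval_at f = 0 <-> exists g : poly_module, ('X - t%:P) *: g = f.
Proof.
split=> [f0|[g <-]]; last first.
  by rewrite eval_at_scale !hornerE subrr scale0r.
suff [g gE] : exists g : poly_module, f - cst (eval_at f) = ('X - t%:P) *: g.
  by exists g; rewrite -gE f0 raddf0 subr0.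
elim/fsupported_ind: f {f0} => [|k v|f g [u uE] [w wE]].
- by exists 0; rewrite !raddf0 addr0.
- have [q qE] : exists q, 'X^k - (t ^+ k)%:P = ('X - t%:P) * q.
    by rewrite rmorphXn subrXX; eexists.
  exists (q *: cst v); rewrite scalerA -qE eval_at_mono scalerBl.
  by rewrite -['X^k]scale1r scale_mono scale1r addn0 scale_mono_const.
- exists (u + w); rewrite scalerDr -uE -wE !raddfD /=.
  by rewrite addrACA.
Qed.

Lemma coef_scale_XsubC (f : poly_module) k :
  coef k.+1 (('X - t%:P) *: f : poly_module) = coef k f - t *: coef k.+1 f.
Proof.
elim/fsupported_ind: f => [|j v|f g IHf IHg].
- by rewrite scaler0 !raddf0 addr0.
- rewrite scalerBl raddfB /=.
  have -> : 'X *: (mono j v : poly_module) = mono j.+1 v.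
    by rewrite -['X]expr1 -['X^1]scale1r scale_mono scale1r.
  rewrite scale_mono_const.
  by rewrite !monalg.mcoeffU eqSS scalerMnr.
- by rewrite scalerDr !raddfD /= IHf IHg addrACA.
Qed.

(** If (y - t) f = 0, each coefficient of f is t times the next one, and the
    coefficients vanish from some degree on. *)
Lemma scale_XsubC_inj : injective (fun f : poly_module => ('X - t%:P) *: f).
Proof.
move=> f g /eqP; rewrite -subr_eq0 -scalerBr => /eqP fg.
apply/eqP; rewrite -subr_eq0; apply/eqP; move: (f - g) fg => {g}f f0.
have coef_step k : coef k.+1 f = 0 -> coef k f = 0.
  move=> fk; have := coef_scale_XsubC f k.
  by rewrite f0 fk scaler0 subr0 raddf0.
pose m := \max_(k <- monalg.msupp f) k.
have coef_big k : (m < k)%N -> coef k f = 0.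
  move=> lt_mk; apply: monalg.mcoeff_outdom; apply: contraL lt_mk => ks.
  by rewrite -leqNgt; apply: leq_bigmax_seq.
have coef0 d k : (m < k + d)%N -> coef k f = 0.
  elim: d k => [|d IHd] k; first by rewrite addn0; apply: coef_big.
  by rewrite addnS -addSn => /IHd/coef_step.
apply/monalg.malgP => k; rewrite raddf0; apply: (coef0 m.+1).
by rewrite addnS ltnS leq_addl.
Qed.

End Evaluation.
End PolynomialModule.
(** * Separating one variable of a polynomial *)

(** W with S acting through phi. *)
Definition restrict_along (S T : nzRingType) (phi : {rmorphism S -> T})
  (W : lmodType T) : Type := W.

Section RestrictScalars.
Variables (S T : nzRingType) (phi : {rmorphism S -> T}) (W : lmodType T).
Local Notation restrict_scalars := (restrict_along phi W).

HB.instance Definition _ := GRing.Zmodule.on restrict_scalars.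

Definition restrict_scale (a : S) (x : restrict_scalars) : restrict_scalars :=
  (phi a *: (x : W) : W).

Fact restrict_scaleA a b x :
  restrict_scale a (restrict_scale b x) = restrict_scale (a * b) x.
Proof. by rewrite /restrict_scale rmorphM scalerA. Qed.

Fact restrict_scale1 : left_id 1 restrict_scale.
Proof. by move=> x; rewrite /restrict_scale rmorph1 scale1r. Qed.

Fact restrict_scaleDr : right_distributive restrict_scale +%R.
Proof. by move=> a x y; apply: (scalerDr (phi a) (x : W) y). Qed.

Fact restrict_scaleDl x : {morph restrict_scale^~ x : a b / a + b}.
Proof. by move=> a b; rewrite /restrict_scale rmorphD scalerDl. Qed.

HB.instance Definition _ := GRing.Zmodule_isLmodule.Build S restrict_scalars
  restrict_scaleA restrict_scale1 restrict_scaleDr restrict_scaleDl.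
End RestrictScalars.

Section PolynomialVariables.
Variables (A : comNzRingType) (n : nat).
Local Notation S := {mpoly A[n]}.

Lemma mpoly_monomial_ind (P : S -> Prop) :
  P 0 -> (forall c m, P (c *: 'X_[m])) -> (forall p q, P p -> P q -> P (p + q)) ->
  forall p, P p.
Proof. by move=> P0 Pmono PD p; rewrite [p]mpolyE; apply: big_ind. Qed.

(** Polynomials in the variables outside s.  They form a subring of S; describing
    it by a condition on coefficients keeps every module over the one ring S. *)
Definition avoids (s : seq 'I_n) (p : S) : Prop :=
  forall (i : 'I_n) (m : 'X_{1..n}), i \in s -> m i != 0%N -> p@_m = 0.

Lemma avoids0 s : avoids s 0.
Proof. by move=> i m _ _; rewrite mcoeff0. Qed.

Lemma avoidsD s p q : avoids s p -> avoids s q -> avoids s (p + q).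
Proof. by move=> hp hq i m si mi; rewrite mcoeffD (hp i) ?(hq i) ?addr0. Qed.

Lemma avoids_mulX s i l p :
  i \notin s -> avoids s p -> avoids s ('X_i ^+ l * p).
Proof.
move=> si hp j m sj mj; rewrite mpolyXn mulrC.
apply: contraTeq mj => /=; rewrite mcoeff_eq0 negbK (perm_mem (msuppMX _ _)).
case/mapP=> u; rewrite mcoeff_msupp => pu ->.
rewrite mnmDE mulmnE mnm1E (_ : i == j = false) ?addn0; last first.
  by apply: contraNF si => /eqP->.
by apply: contraNN pu => uj; rewrite (hp j).
Qed.

Lemma avoids_mpolyC s c : avoids s c%:MP.
Proof.
move=> i m _ mi; rewrite mcoeffC [m == _](_ : _ = false) ?mulr0 //.
by apply: contraNF mi => /eqP->; rewrite mnm0E.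
Qed.

Lemma avoids_all_const p : avoids (enum 'I_n) p -> p = (p@_0)%:MP.
Proof.
move=> hp; apply/mpolyP => m; rewrite mcoeffC.
have [->|m_neq0] := eqVneq m 0%MM; first by rewrite mulr1.
rewrite mulr0; have [i mi] : exists i, m i != 0%N.
  apply: contrapT => noi; case/eqP: m_neq0; apply/mnmP => i; rewrite mnm0E.
  by apply/eqP; apply: contrapT => /negP mi; apply: noi; exists i.
by apply: (hp i); rewrite ?mem_enum.
Qed.

Variable i : 'I_n.

Definition strip (m : 'X_{1..n}) : 'X_{1..n} :=
  [multinom if j == i then 0%N else m j | j < n].

(** S -> S[y] with x_i sent to y and the other variables fixed.  It is locked
    because unification would otherwise try to compare two of its values by
    unfolding the sums behind [mmap]. *)
Fact split_var_key : unit. Proof. by []. Qed.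
Definition split_var : S -> {poly S} :=
  locked_with split_var_key
    (mmap (polyC \o @mpolyC n A) (fun j => if j == i then 'X else ('X_j)%:P)).

Lemma split_varE : split_var =
  mmap (polyC \o @mpolyC n A) (fun j => if j == i then 'X else ('X_j)%:P).
Proof. exact: locked_withE. Qed.

Fact split_var_is_additive : zmod_morphism split_var.
Proof. by rewrite split_varE; apply: raddfB. Qed.

Fact split_var_is_multiplicative : monoid_morphism split_var.
Proof. by rewrite split_varE; split; [apply: rmorph1 | apply: rmorphM]. Qed.

HB.instance Definition _ := GRing.isZmodMorphism.Build S {poly S} split_var
  split_var_is_additive.
HB.instance Definition _ := GRing.isMonoidMorphism.Build S {poly S} split_var
  split_var_is_multiplicative.

Fact split_var0 : split_var 0 = 0.
Proof. exact: rmorph0. Qed.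

Fact split_varD p q : split_var (p + q) = split_var p + split_var q.
Proof. exact: rmorphD. Qed.

Lemma split_var_mono c m :
  split_var (c *: 'X_[m]) = (c *: 'X_[strip m]) *: 'X^(m i).
Proof.
rewrite split_varE [LHS]mmapZ mmapX /= mul_polyC -mul_mpolyC -scalerA; congr (_ *: _).
rewrite /mmap1 mpolyXE_id (bigD1 i) //= [in RHS](bigD1 i) //= eqxx.
rewrite mnmE eqxx expr0 mul1r mulrC -mul_polyC rmorph_prod; congr (_ * _).
by apply: eq_bigr => j /negbTE ji; rewrite mnmE ji rmorphXn.
Qed.

Lemma strip_add m : (strip m + U_(i) *+ m i)%MM = m.
Proof.
apply/mnmP => j; rewrite mnmDE mulmnE mnm1E mnmE eq_sym.
by case: eqP => [->|_]; rewrite ?mul1n ?mul0n ?addn0.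
Qed.

Lemma split_varK p : (split_var p).['X_i] = p.
Proof.
elim/mpoly_monomial_ind: p => [|c m|p q IHp IHq].
- by rewrite split_var0 horner0.
- by rewrite split_var_mono hornerZ hornerXn mpolyXn -scalerAl -mpolyXD strip_add.
- by rewrite split_varD hornerD; congr (_ + _).
Qed.

Lemma split_varX l : split_var ('X_i ^+ l) = 'X^l.
Proof. by rewrite rmorphXn /= split_varE [mmap _ _ _]mmapX mmap1U eqxx. Qed.

Lemma coef_split_var p l (m : 'X_{1..n}) :
  ((split_var p)`_l)@_m = if m i == 0%N then p@_(m + U_(i) *+ l) else 0.
Proof.
elim/mpoly_monomial_ind: p => [|c u|p q IHp IHq].
- by rewrite split_var0 coef0 !mcoeff0 if_same.
- rewrite split_var_mono coefZ coefXn mulr_natr mcoeffMn !mcoeffZ !mcoeffX.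
  have strip_i : strip u i = 0%N by rewrite mnmE eqxx.
  case: ifPn => [/eqP mi|mi]; last first.
    by case: eqP => [uE|_]; [rewrite -uE strip_i in mi | rewrite mulr0 mul0rn].
  suff -> : (u == m + U_(i) *+ l)%MM = (strip u == m) && (l == u i).
    by case: eqP; case: eqP; rewrite ?mulr0 ?mul0rn.
  apply/eqP/andP=> [->|[/eqP <- /eqP ->]]; last by rewrite strip_add.
  split; last by rewrite mnmDE mulmnE mnm1E eqxx mul1n mi.
  apply/eqP/mnmP => j; rewrite mnmE mnmDE mulmnE mnm1E eq_sym.
  by case: eqP => [<-|_]; rewrite ?mi // addn0.
- by rewrite split_varD coefD !mcoeffD IHp IHq; case: ifP => //; rewrite addr0.
Qed.

Lemma split_var_avoids s p : i \in s -> avoids s p -> split_var p = p%:P.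
Proof.
move=> si hp; apply/polyP => l; apply/mpolyP => m.
rewrite coef_split_var coefC; case: ifPn => mi.
  case: eqP => [->|/eqP l0]; first by rewrite mulm0n addm0.
  rewrite (hp i) ?mcoeff0 //.
  by rewrite mnmDE mulmnE mnm1E eqxx mul1n addn_eq0 negb_and l0 orbT.
by case: eqP => _; rewrite ?(hp i) ?mcoeff0.
Qed.

Lemma avoids_split_var s p l : avoids s p -> avoids (i :: s) (split_var p)`_l.
Proof.
move=> hp j m jis mj; rewrite coef_split_var; case: eqP => // mi.
have sj : j \in s.
  by move: jis; rewrite inE => /predU1P[ji|//]; rewrite ji mi in mj.
by apply: (hp j) => //; rewrite mnmDE addn_eq0 negb_and mj.
Qed.
End PolynomialVariables.

(** * Freeness over a polynomial ring in some of the variables *)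

Section RelativeFreeness.
Variables (A : comNzRingType) (n : nat).
Local Notation S := {mpoly A[n]}.

(** N is free over the polynomial ring in the variables outside s, with basis b.
    For s empty this is freeness over S, and when s lists all the variables it is
    freeness over the coefficient ring. *)
Definition free_avoiding (s : seq 'I_n) (N : lmodType S) : Prop :=
  exists (I : choiceType) (b : I -> N),
    (forall x, exists2 f : fsupported I S,
       (forall k, avoids s (coef k f)) & x = lincomb b f) /\
    (forall f : fsupported I S,
       (forall k, avoids s (coef k f)) -> lincomb b f = 0 -> f = 0).

(** N[y] with x_i acting as y. *)
Definition adjoin (i : 'I_n) (N : lmodType S) : lmodType S :=
  restrict_along (split_var i : {rmorphism S -> {poly S}}) (poly_module N).

Lemma coef_scale_const (N : lmodType S) (p : {poly S}) (v : N) l :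
  coef l (p *: (mono 0%N v : poly_module N)) = p`_l *: v.
Proof.
elim/poly_monomial_ind: p => [|a c|p q IHp IHq].
- by rewrite scale0r raddf0 coef0 scale0r.
- rewrite scale_mono monalg.mcoeffU coefZ coefXn addn0 mulr_natr scalerMnl.
  by rewrite eq_sym.
- by rewrite scalerDl raddfD /= IHp IHq coefD scalerDl.
Qed.

Section Step.
Variables (i : 'I_n) (s : seq 'I_n) (N : lmodType S).
Hypothesis si : i \notin s.

Local Notation cst v := (mono 0%N v : adjoin i N).

Lemma adjoinE (p : S) (x : adjoin i N) :
  p *: x = (split_var i p *: (x : poly_module N) : poly_module N).
Proof. by []. Qed.

(** A basis b of N is one of N[y]: a polynomial avoiding x_i acts on the constants
    of N[y] as on N, and x_i^l moves these constants to degree l.  Conversely, the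
    degree l part of a relation between the constants b k is a relation in N whose
    coefficients avoid x_i. *)
Lemma free_adjoin : free_avoiding (i :: s) N -> free_avoiding s (adjoin i N).
Proof.
move=> [I [b [b_span b_indep]]]; pose b' k := cst (b k); exists I, b'.
split=> [x|f f_avoids f0].
  elim/fsupported_ind: x => [|l v|x y [f hf ->] [g hg ->]].
  - by exists 0 => [k|]; rewrite raddf0 //; apply: avoids0.
  - have [f hf ->] := b_span v; exists ('X_i ^+ l *: f) => [k|].
      rewrite monalg.mcoeffZ; apply: avoids_mulX => // j m sj.
      by apply: hf; rewrite inE sj orbT.
    have -> : mono l (lincomb b f) = 'X_i ^+ l *: cst (lincomb b f) :> adjoin i N.
      by rewrite adjoinE split_varX -['X^l]scale1r scale_mono addn0 scale1r.
    rewrite linearZ /=; congr (_ *: _).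
    rewrite /lincomb /extend raddf_sum; apply: eq_bigr => k _ /=.
    rewrite adjoinE (split_var_avoids _ (hf k)) ?mem_head //.
    exact: esym (scale_mono_const _ _ _).
  - by exists (f + g) => [k|]; rewrite raddfD //=; apply: avoidsD.
pose slice l : {additive fsupported I S -> fsupported I S} :=
  extend (fun k => mono k \o (coefp l \o split_var i)).
have slice_coef l k g : coef k (slice l g) = (split_var i (coef k g))`_l.
  elim/fsupported_ind: g => [|j c|g h IHg IHh].
  - by rewrite !raddf0 coef0.
  - rewrite [slice l _]extend_mono /= !monalg.mcoeffU.
    by case: eqP => // _; rewrite !mulr0n raddf0 coef0.
  - by rewrite !raddfD /= IHg IHh coefD.
have comb_slice l g : lincomb b (slice l g) = coef l (lincomb b' g).
  elim/fsupported_ind: g => [|j c|g h IHg IHh].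
  - by rewrite !raddf0.
  - rewrite lincomb_mono adjoinE coef_scale_const.
    by rewrite [slice l _]extend_mono /= lincomb_mono.
  - by rewrite !raddfD /= IHg IHh.
apply/monalg.malgP => k; rewrite raddf0 -[RHS](split_varK i) -[coef k f](split_varK i).
congr horner; rewrite raddf0; apply/polyP => l; rewrite coef0 -slice_coef.
rewrite (b_indep (slice l f)) ?raddf0 // => [j|]; last by rewrite comb_slice f0 raddf0.
by rewrite slice_coef; apply: avoids_split_var.
Qed.

End Step.

(** Both maps are S-linear since x_i acts on N[y] as y and on the quotient by
    y - x_i as x_i: a polynomial p acts as [split_var i p], whose value at x_i is
    p. *)
Lemma adjoin_exact (i : 'I_n) (N : lmodType S) :
  exists (d : {linear adjoin i N -> adjoin i N}) (e : {linear adjoin i N -> N}),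
    short_exact d e.
Proof.
have [|d dE] := @linear_of _ (adjoin i N) (adjoin i N)
  (fun f => ('X - ('X_i)%:P) *: (f : poly_module N) : poly_module N).
  move=> p f g; rewrite !adjoinE.
  rewrite (scalerDr ('X - ('X_i)%:P : {poly S}) (_ *: _ : poly_module N) g).
  by rewrite !scalerA mulrC.
have [|e eE] := @linear_of _ (adjoin i N) N (@eval_at _ N 'X_i).
  move=> p f g; rewrite [LHS](raddfD (@eval_at _ N 'X_i)) adjoinE /=.
  by rewrite eval_at_scale split_varK.
exists d, e; split=> [f g|v|f].
- by rewrite !dE; apply: scale_XsubC_inj.
- by exists (mono 0%N v); rewrite eE; apply: eval_at_surj.
- rewrite eE; apply: (iff_trans (eval_at_kernel _ _)).
  by split=> -[g gE]; exists g; rewrite -gE dE.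
Qed.

Lemma free_avoiding_free (N : lmodType S) : free_avoiding [::] N -> free_module N.
Proof.
move=> [I [b [b_span b_indep]]]; exists I, (lincomb b).
have comb_surj x : exists f, lincomb b f = x.
  by have [f _ ->] := b_span x; exists f.
have [g gK] := choice comb_surj; exists g => // f.
apply/eqP; rewrite -subr_eq0; apply/eqP/b_indep => //.
by rewrite raddfB /= gK subrr.
Qed.

Lemma free_avoiding_dim_le (s : seq 'I_n) (N : lmodType S) :
  uniq s -> free_avoiding s N -> free_dim_le (size s) N.
Proof.
elim: s N => [|i s IHs] N /=; first by move=> _; apply: free_avoiding_free.
case/andP=> si s_uniq Nfree.
have adj_res := IHs _ s_uniq (free_adjoin si Nfree).
have [d [e de]] := adjoin_exact i N.
exact: (free_dim_le_cokernel de adj_res adj_res).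
Qed.
End RelativeFreeness.
(** * Monomial orders are well founded *)

Section WellFoundedness.

Lemma wf_of_no_descent (T : Type) (R : T -> T -> Prop) :
  (forall u : nat -> T, exists k, ~ R (u k.+1) (u k)) -> well_founded R.
Proof.
move=> nodesc x; apply: contrapT => xNacc.
have next (y : {y | ~ Acc R y}) : exists z : {y | ~ Acc R y}, R (sval z) (sval y).
  case: y => y yNacc /=; apply: contrapT => noz; apply: yNacc.
  constructor=> z Rzy; apply: contrapT => zNacc; apply: noz.
  by exists (exist _ z zNacc).
have [nxt nxtR] := choice next.
have [k] := nodesc (fun k => sval (iter k nxt (exist _ x xNacc))).
by apply; apply: nxtR.
Qed.

Lemma nondecreasing_subsequence (u : nat -> nat) :
  exists2 phi : nat -> nat, {homo phi : i j / (i < j)%N}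
    & {homo u \o phi : i j / (i <= j)%N}.
Proof.
have min_tail N : exists k, (N <= k)%N /\ forall k', (N <= k')%N -> (u k <= u k')%N.
  have tailP : exists v, `[< exists2 k, (N <= k)%N & u k = v >].
    by exists (u N); apply/asboolP; exists N.
  have [_ /asboolP[k Nk <-] umin] := ex_minnP tailP.
  by exists k; split=> // k' Nk'; apply: umin; apply/asboolP; exists k'.
(* K N is a place where u is minimal from N on; phi jumps from one such place
   to the next. *)
have [K KP] := choice min_tail.
pose phi := fix phi i := if i is i'.+1 then K (phi i').+1 else K 0%N.
have phi_step i : (phi i < phi i.+1)%N by have [] := KP (phi i).+1.
have phi_min i k : (phi i <= k)%N -> (u (phi i) <= u k)%N.
  case: i => [|i]; first by move=> _; apply: (KP 0%N).2.
  by move=> le_ik; apply: (KP (phi i).+1).2; apply: leq_trans le_ik.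
have phi_mono : {homo phi : i j / (i < j)%N}.
  exact: (homo_ltn (@ltn_trans)).
exists phi => // i j /=; rewrite leq_eqVlt => /predU1P[-> //|ij].
by apply: phi_min; apply/ltnW/phi_mono.
Qed.

Lemma common_nondecreasing_subsequence (T : eqType) (v : T -> nat -> nat) (s : seq T) :
  exists2 phi : nat -> nat, {homo phi : i j / (i < j)%N}
    & forall x, x \in s -> {homo v x \o phi : i j / (i <= j)%N}.
Proof.
elim: s => [|y s [phi phi_mono vphi]]; first by exists id.
have [psi psi_mono vpsi] := nondecreasing_subsequence (v y \o phi).
exists (phi \o psi) => [i j ij|x]; first by apply/phi_mono/psi_mono.
rewrite inE => /predU1P[->|xs i j ij]; first exact: vpsi.
apply: (vphi x xs (psi i) (psi j)).
by move: ij; rewrite leq_eqVlt => /predU1P[-> //|/psi_mono/ltnW].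
Qed.

(** Dickson's lemma: an infinite descending sequence would contain two terms, the
    earlier dividing the later, but a multiple is never smaller. *)
Lemma monomial_order_wf n r (gt : rel (fmon n r)) :
  is_monomial_order gt -> well_founded (fun m m' => gt m' m).
Proof.
case=> irr trans _ gt_mul _; apply: wf_of_no_descent => u; apply: contrapT => noex.
have desc k : gt (u k) (u k.+1).
  by apply: contrapT => ngt; apply: noex; exists k.
have descl : forall i j, (i < j)%N -> gt (u i) (u j).
  exact: (homo_ltn (r := gt) (fun y x z => @trans y x z)).
(* Besides the exponents, follow the component and its complement: if neither
   decreases, the component is constant. *)
pose v (x : 'I_n + bool) k : nat :=
  match x with
  | inl i => (u k).1 i
  | inr true => (u k).2
  | inr false => (r - (u k).2)%N
  end.
have [phi phi_mono vphi] := common_nondecreasing_subsequence v (enum {: 'I_n + bool}).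
have vle x : (v x (phi 0%N) <= v x (phi 1%N))%N by apply: vphi; rewrite ?mem_enum.
have := descl _ _ (phi_mono 0 1 isT)%N.
have -> : u (phi 1%N) = fmon_mul ((u (phi 1%N)).1 - (u (phi 0%N)).1)%MM (u (phi 0%N)).
  rewrite /fmon_mul submK; last by apply/mnm_lepP => i; apply: (vle (inl i)).
  rewrite [LHS]surjective_pairing; congr (_, _); apply/val_inj/eqP.
  rewrite eqn_leq (vle (inr true)) andbT.
  by have := vle (inr false); rewrite /v /= leq_sub2lE // ltnW.
set w := (_ - _)%MM; have [->|w0] := eqVneq w 0%MM.
  by rewrite /fmon_mul add0m -surjective_pairing irr.
by move=> g1; have := trans _ _ _ (gt_mul _ _ w0) g1; rewrite irr.
Qed.

End WellFoundedness.

(** * Groebner bases with invertible leading coefficients *)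

Local Open Scope quotient_scope.

Lemma quot_module_projection (S : nzRingType) (V : lmodType S)
    (U : submodClosed V) :
  exists q : {linear V -> quot_module U},
    (forall x, exists v, q v = x) /\ (forall v, q v = 0 <-> v \in U).
Proof.
have [|q qE] := @linear_of S V (quot_module U) (\pi_(quot_module U)).
  by move=> a v w; rewrite quot_piD -quot_scale_pi.
exists q; split=> [x|v]; first by exists (repr x); rewrite qE reprK.
by rewrite -(linear0 q) !qE; rewrite quot_moduleE subr0.
Qed.

Section GroebnerBases.
Variables (A : comNzRingType) (n r : nat).
Local Notation S := {mpoly A[n]}.
Local Notation F := 'rV[S]_r.
Implicit Types (f g : F) (m l : fmon n r).

Lemma fcoeffD f g m : fcoeff (f + g) m = fcoeff f m + fcoeff g m.
Proof. by rewrite /fcoeff mxE mcoeffD. Qed.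

Lemma fcoeffB f g m : fcoeff (f - g) m = fcoeff f m - fcoeff g m.
Proof. by rewrite /fcoeff !mxE mcoeffD mcoeffN. Qed.

Lemma fcoeff0 m : fcoeff (0 : F) m = 0.
Proof. by rewrite /fcoeff mxE mcoeff0. Qed.

Lemma fcoeff_sum (T : Type) (s : seq T) (E : T -> F) m :
  fcoeff (\sum_(x <- s) E x) m = \sum_(x <- s) fcoeff (E x) m.
Proof.
by apply: (big_morph (fun f => fcoeff f m)) => [f g|]; rewrite ?fcoeffD ?fcoeff0.
Qed.

Lemma fcoeff_constZ (c : A) f m : fcoeff (c%:MP *: f) m = c * fcoeff f m.
Proof. by rewrite /fcoeff mxE mcoeffCM. Qed.

Lemma fcoeff_fmon_elt l m : fcoeff (fmon_elt A l) m = (l == m)%:R.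
Proof.
rewrite /fcoeff !mxE eqxx /= mulr_natr mcoeffMn mcoeffX.
case: l m => [u i] [w j] /=; rewrite xpair_eqE [j == i]eq_sym.
by case: (i == j); rewrite ?andbT ?andbF.
Qed.

Lemma fcoeff_scale_fmon_elt (p : S) l m :
  fcoeff (p *: fmon_elt A l) m != 0 -> (l.1 <= m.1)%MM && (l.2 == m.2).
Proof.
rewrite /fcoeff !mxE eqxx /= [m.2 == l.2]eq_sym.
have [_|_] := eqVneq l.2 m.2; last by rewrite !mulr0 mcoeff0 eqxx.
rewrite mulr1 andbT -mcoeff_msupp (perm_mem (msuppMX _ _)) => /mapP[u _ ->].
exact: lem_addr.
Qed.

Lemma fcoeff_mulX w f m : fcoeff ('X_[w] *: f) (fmon_mul w m) = fcoeff f m.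
Proof. by rewrite /fcoeff mxE mulrC /= mcoeffMX. Qed.

Lemma fcoeff_mulX_neq0 w f m :
  fcoeff ('X_[w] *: f) m != 0 -> exists2 l, m = fmon_mul w l & fcoeff f l != 0.
Proof.
case: m => u i; rewrite /fcoeff mxE mulrC -mcoeff_msupp (perm_mem (msuppMX _ _)).
by case/mapP=> u'; rewrite mcoeff_msupp => fu' /= ->; exists (u', i).
Qed.

Lemma mem_fsupp f m : (m \in fsupp f) = (fcoeff f m != 0).
Proof.
case: m => u i; rewrite -mcoeff_msupp /=.
apply/allpairsPdep/idP => [[j [w [_ wf [-> ->]]]] //|uf].
by exists i, u; rewrite mem_enum.
Qed.

Lemma fmon_expansion f :
  f = \sum_(m <- fsupp f) (fcoeff f m)%:MP *: fmon_elt A m.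
Proof.
rewrite big_allpairs_dep /= big_enum {1}[f]row_sum_delta; apply: eq_bigr => i _.
rewrite {1}[f 0 i]mpolyE scaler_suml; apply: eq_bigr => u _.
by rewrite /fmon_elt scalerA mul_mpolyC.
Qed.

Variable gt : rel (fmon n r).
Hypothesis gtP : is_monomial_order gt.

Lemma lmon_exists f : f != 0 -> exists2 l, lmon gt f = Some l
  & fcoeff f l != 0 /\ forall m, fcoeff f m != 0 -> (l == m) || gt l m.
Proof.
case: gtP => _ trans total _ _ f_neq0.
have max_ex (s : seq (fmon n r)) : s != [::] ->
    exists2 l, l \in s & all (fun m => (l == m) || gt l m) s.
  elim: s => // m [_ _|m' s /(_ isT) [l ls /allP lmax] _].
    by exists m; rewrite ?mem_head //= eqxx.
  have [ml|ml] := boolP ((l == m) || gt l m).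
    exists l; first by rewrite in_cons ls orbT.
    by apply/allP => x; rewrite in_cons => /predU1P[->|/lmax].
  exists m; first exact: mem_head.
  apply/allP => x; rewrite in_cons => /predU1P[->|/lmax]; first by rewrite eqxx.
  move: ml; rewrite negb_or => /andP[lm /negbTE ngt].
  have gml : gt m l by move: (total _ _ lm); rewrite ngt.
  by case/predU1P => [<-|/(trans _ _ _ gml) ->]; rewrite ?gml orbT.
have supp_neq0 : fsupp f != [::].
  apply: contra_neq f_neq0 => s0; rewrite [f]fmon_expansion s0; exact: big_nil.
have [l ls lmax] := max_ex _ supp_neq0.
rewrite /lmon; set t := filter _ _.
have lt : l \in t by rewrite mem_filter lmax.
case tE: t lt => [//|l' t'] _; exists l' => //.
have : l' \in t by rewrite tE mem_head.
rewrite mem_filter => /andP[/allP l'max]; rewrite mem_fsupp => fl'; split=> // m.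
by rewrite -mem_fsupp => /l'max.
Qed.

Variables (U : submodClosed F) (G : seq F).
Hypothesis groebnerG : is_groebner_basis gt (fun f => f \in U) G.

Definition standard (m : 'X_{1..n} * 'I_r) : bool :=
  all (fun g => if lmon gt g is Some l
                then ~~ ((l.1 <= m.1)%MM && (l.2 == m.2)) else true) G.

(** LT(f) is a combination of the leading terms of G, so its monomial is a multiple
    of one of theirs. *)
Lemma lmon_not_standard f l :
  f \in U -> f != 0 -> lmon gt f = Some l -> ~~ standard l.
Proof.
case: groebnerG => _ _ LTG Uf f_neq0 fl.
have [l' fl' [fl'_neq0 _]] := lmon_exists f_neq0.
move: fl'; rewrite fl => -[ll']; rewrite -{l'}ll' in fl'_neq0.
have LTf : in_LT gt (fun h => h \in U) (LT gt f).
  exists [:: (1, LT gt f)]; split; last by rewrite big_seq1 scale1r.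
  by move=> c; rewrite inE => /eqP-> /=; exists f.
have [s [sG LTfE]] := (LTG _).2 LTf.
have : fcoeff (LT gt f) l != 0.
  by rewrite /LT /lc fl fcoeff_constZ fcoeff_fmon_elt eqxx mulr1.
apply: contra => l_std; rewrite LTfE fcoeff_sum big_seq big1 // => c /sG.
case=> g [gG g_neq0 ->]; apply/eqP; move: l_std => /allP/(_ g gG).
have [k gk _] := lmon_exists g_neq0.
rewrite /LT gk scalerA; apply: contraNT; exact: fcoeff_scale_fmon_elt.
Qed.

Definition standard_monomial : choiceType :=
  {m : 'X_{1..n} * 'I_r | standard m}.

Definition standard_elt (k : standard_monomial) : F := fmon_elt A (val k).

Lemma fcoeff_standard (h : fsupported standard_monomial S) m :
  (forall k, avoids (enum 'I_n) (coef k h)) ->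
  fcoeff (lincomb standard_elt h) m =
    if insub m is Some k then (coef k h)@_0 else 0.
Proof.
move=> h_const; rewrite /lincomb /extend fcoeff_sum.
have termE k : fcoeff (coef k h *: standard_elt k) m =
    (coef k h)@_0 * (val k == m)%:R.
  by rewrite (avoids_all_const (h_const k)) fcoeff_constZ fcoeff_fmon_elt mpolyCK.
rewrite (eq_bigr _ (fun k _ => termE k)); case: insubP => [j m_std jE|m_nstd].
  have valE k : (val k == m) = (k == j) by rewrite -jE val_eqE.
  under eq_bigr do rewrite valE mulr_natr mulrb.
  rewrite -big_mkcond /=.
  have [jh|/monalg.mcoeff_outdom hj] := boolP (j \in monalg.msupp h).
    by rewrite -big_filter filter_pred1_uniq ?fset_uniq // big_seq1.
  by rewrite hj mcoeff0 big1 // => k /eqP->; rewrite hj mcoeff0.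
rewrite big1 // => k _; rewrite [_ == m](_ : _ = false) ?mulr0 //.
by apply: contraNF m_nstd => /eqP <-; apply: valP.
Qed.

(** A relation between standard monomials modulo U would be an element of U
    whose largest monomial is standard. *)
Lemma standard_independent (h : fsupported standard_monomial S) :
  (forall k, avoids (enum 'I_n) (coef k h)) ->
  lincomb standard_elt h \in U -> h = 0.
Proof.
move=> h_const; set f := lincomb _ h => fU.
have f0 : f = 0.
  apply: contrapT => /eqP f_neq0.
  have [l fl [fl_neq0 _]] := lmon_exists f_neq0.
  have := lmon_not_standard fU f_neq0 fl; apply/negP; rewrite negbK.
  by move: fl_neq0; rewrite (fcoeff_standard _ h_const); case: insubP; rewrite ?eqxx.
apply/monalg.malgP => k; rewrite raddf0 (avoids_all_const (h_const k)).
have := fcoeff_standard (val k) h_const; rewrite -/f f0 fcoeff0 valK => <-.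
exact: mpolyC0.
Qed.

Hypothesis lcG : forall g, g \in G -> exists c, c * lc gt g = 1.

(** The division algorithm: a monomial that is not standard is w * lmon g for
    some g in G, and since lc g is invertible it agrees modulo U with a
    combination of smaller monomials.  The rewriting stops because the order is
    well founded. *)
Lemma standard_span f :
  exists2 h : fsupported standard_monomial S,
    forall k, avoids (enum 'I_n) (coef k h) & f - lincomb standard_elt h \in U.
Proof.
pose reducible f := exists2 h : fsupported standard_monomial S,
  forall k, avoids (enum 'I_n) (coef k h) & f - lincomb standard_elt h \in U.
rewrite -/(reducible f).
have reducibleD f1 f2 : reducible f1 -> reducible f2 -> reducible (f1 + f2).
  move=> [h1 h1_const Uf1] [h2 h2_const Uf2]; exists (h1 + h2).
    by move=> k; rewrite raddfD /=; apply: avoidsD.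
  have -> : lincomb standard_elt (h1 + h2) =
      lincomb standard_elt h1 + lincomb standard_elt h2 by exact: linearD.
  by rewrite opprD addrACA; exact: (rpredD Uf1 Uf2).
have reducibleZ c f1 : reducible f1 -> reducible (c%:MP *: f1).
  move=> [h h_const Uf1]; exists (c%:MP *: h).
    move=> k; rewrite monalg.mcoeffZ (avoids_all_const (h_const k)) -mpolyCM.
    exact: avoids_mpolyC.
  by rewrite linearZ /= -scalerBr; apply: rpredZ.
have reducible0 : reducible 0.
  exists 0 => [k|]; first by rewrite raddf0; apply: avoids0.
  by rewrite linear0 subr0; apply: rpred0.
have reducible_supp f1 :
    (forall m, fcoeff f1 m != 0 -> reducible (fmon_elt A m)) -> reducible f1.
  move=> f1_red; rewrite [f1]fmon_expansion big_seq; apply: big_ind => // m.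
  by rewrite mem_fsupp => /f1_red; apply: reducibleZ.
suff mon_red m : reducible (fmon_elt A m) by apply: reducible_supp.
elim/(well_founded_ind (monomial_order_wf gtP)): m => m IHm.
have [m_std|] := boolP (standard m).
  exists (mono (Sub m m_std : standard_monomial) 1).
    move=> k; rewrite monalg.mcoeffU; case: eqP => _; last exact: avoids0.
    by rewrite mulr1n -mpolyC1; apply: avoids_mpolyC.
  by rewrite lincomb_mono scale1r /standard_elt SubK subrr; apply: rpred0.
case/allPn=> g gG; have [GU G_neq0 _] := groebnerG.
have [l gl [gl_neq0 g_max]] := lmon_exists (G_neq0 g gG).
rewrite gl negbK => /andP[lm1 /eqP lm2].
have [c] := lcG gG; rewrite /lc gl => c_lc.
pose w := (m.1 - l.1)%MM.
have mE : m = fmon_mul w l by rewrite /fmon_mul submK // lm2 -surjective_pairing.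
have gm : fcoeff ('X_[w] *: g) m = fcoeff g l by rewrite mE fcoeff_mulX.
(* The multiple of g subtracted from m cancels m and brings in smaller monomials. *)
pose tail := fmon_elt A m - c%:MP *: ('X_[w] *: g).
have [|h h_const Uh] := reducible_supp tail; last first.
  exists h => //; rewrite -[fmon_elt A m](subrK (c%:MP *: ('X_[w] *: g))) addrAC.
  by apply: rpredD => //; do 2!apply: rpredZ; apply: GU.
move=> k; rewrite fcoeffB fcoeff_constZ fcoeff_fmon_elt.
have [<-|mk] := eqVneq m k; first by rewrite gm c_lc subrr eqxx.
rewrite sub0r oppr_eq0 => ck; apply: IHm.
have [|k' kE gk'] := @fcoeff_mulX_neq0 w g k.
  by apply: contraNneq ck => ->; rewrite mulr0.
case: gtP => _ _ _ _ gt_mul; rewrite mE kE; apply: gt_mul.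
have /orP[/eqP lk|//] := g_max _ gk'.
by case/eqP: mk; rewrite mE kE lk.
Qed.

Lemma quotient_free_avoiding : free_avoiding (enum 'I_n) (quot_module U).
Proof.
have [q [q_surj q_ker]] := quot_module_projection U.
have q_lincomb h : q (lincomb standard_elt h) = lincomb (q \o standard_elt) h.
  by rewrite /lincomb /extend raddf_sum; apply: eq_bigr => k _; rewrite /= linearZ.
exists standard_monomial, (q \o standard_elt); split=> [x|h h_const h0].
  have [f <-] := q_surj x; have [h h_const Uh] := standard_span f; exists h => //.
  by apply/eqP; rewrite -q_lincomb -subr_eq0 -linearB; apply/eqP/q_ker.
by apply: standard_independent => //; apply/q_ker; rewrite q_lincomb.
Qed.

End GroebnerBases.

(** Lift a to x and let g generate the ideal (x, N), with N = N' g.  Then a kills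
    the class of N', so N divides N' and g is a unit; a Bezout relation for g then
    inverts a. *)
Lemma nonzerodivisor_quot_unit (R : idomainType) (N : R)
    (hN : N \isn't a GRing.unit) (a : quot_principal hN) :
  is_pid R -> N != 0 -> nonzerodivisor a -> exists c, c * a = 1.
Proof.
move=> pidR N_neq0 a_nzd.
pose q : {rmorphism R -> quot_principal hN} := \pi_(quot_principal hN).
have q_eq0 x : q x = 0 <-> exists y, x = y * N.
  have e := @Quotient.idealrBE _ (Idealr.clone R (multiples hN) _) x 0.
  rewrite -(rmorph0 q); split=> [/eqP qx|xN].
    by move: e; rewrite subr0 [RHS]qx => /asboolP.
  by apply/eqP; move: e; rewrite subr0 => <-; apply/asboolP.
have [x aE] : exists x, a = q x by exists (repr a); rewrite /q /= reprK.
have [|||g gP] := pidR (fun z => exists u v, z = u * x + v * N).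
- by exists 0, 0; rewrite !mul0r addr0.
- move=> _ _ [u [v ->]] [u' [v' ->]]; exists (u + u'), (v + v').
  by rewrite !mulrDl addrACA.
- move=> c _ [u [v ->]]; exists (c * u), (c * v).
  by rewrite mulrDr !mulrA.
have [x' xE] : exists x', x = x' * g by apply/gP; exists 1, 0; rewrite mul1r mul0r addr0.
have [N' NE] : exists N', N = N' * g by apply/gP; exists 0, 1; rewrite mul1r mul0r add0r.
have [u [v gE]] : exists u v, g = u * x + v * N by apply/gP; exists 1; rewrite mul1r.
have /q_eq0[c N'E] : q N' = 0.
  apply: a_nzd; rewrite aE -rmorphM; apply/q_eq0; exists x'.
  by rewrite xE NE mulrAC mulrA.
have cg1 : c * g = 1.
  have N'_neq0 : N' != 0 by apply: contra_neq N_neq0 => N'0; rewrite NE N'0 mul0r.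
  by apply: (mulfI N'_neq0); rewrite mulr1 [RHS]N'E [in RHS]NE mulrCA.
exists (q (c * u)); rewrite aE -rmorphM -(rmorph1 q) -cg1.
apply/eqP; rewrite -subr_eq0 -rmorphB; apply/eqP/q_eq0; exists (- (c * v)).
by rewrite [in LHS]gE mulrDr !mulrA opprD addrA subrr add0r mulNr.
Qed.

Theorem corollary5p7 (R : idomainType) (hR : is_pid R)
    (N : R) (hN0 : N != 0) (hN : N \isn't a GRing.unit) (n : nat)
    (M : lmodType {mpoly (quot_principal hN)[n]})
    (hM : finitely_generated M)
    (r : nat)
    (U : submodClosed 'rV[{mpoly (quot_principal hN)[n]}]_r)
    (hMU : isomorphic M (quot_module U))
    (gt : rel (fmon n r)) (hgt : is_monomial_order gt)
    (G : seq 'rV[{mpoly (quot_principal hN)[n]}]_r)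
    (hG : is_groebner_basis gt (fun f => f \in U) G)
    (hlc : forall g, g \in G -> nonzerodivisor (lc gt g)) :
  exists2 p : nat, (p <= n.+1)%N & has_free_resolution M p.
Proof.
exists n => //.
have lc_unit g : g \in G -> exists c, c * lc gt g = 1.
  by move=> /hlc; apply: nonzerodivisor_quot_unit.
apply: (resolution_isomorphic hMU); apply: free_dim_le_resolution.
rewrite -[X in free_dim_le X](size_enum_ord n).
by apply: free_avoiding_dim_le (enum_uniq _) (quotient_free_avoiding hgt hG lc_unit).
Qed.
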